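(* Let $S$ be an inverse semigroup with zero and let $E$ be its semilattice of idempotents. The following are equivalent: (i) $S\ltimes\partial\widehat E$ is topologically free. (ii) $S^c\ltimes\partial\widehat E$ is topologically free. (iii) For all $s\in S^c$ and $e,f_1,\dots,f_n\in E$ with $f_i\le e\le s^{-1}s$ for all $1\le i\le n$ such that there exists $0\ne f\le e$ with $ff_i=0$ for all $1\le i\le n$, there exists $0\ne f'\le e$ with $f'f_i=0$ for all $1\le i\le n$ and $sf'=f'$.
   Context: $\widehat E$ is the space of non-zero multiplicative maps $\chi:E\to\{0,1\}$ with $\chi(0)=0$, with the topology of pointwise convergence. $\widehat E_{\max}\subseteq\widehat E$ is the set of $\chi$ with $\chi^{-1}(1)$ maximal (with respect to inclusion) among all $\chi^{-1}(1)$, $\chi\in\widehat E$, and $\partial\widehat E:=\overline{\widehat E_{\max}}$ (the space of tight filters). $s\in S$ acts via the partial homeomorphism $\{\chi:\chi(s^{-1}s)=1\}\to\{\chi:\chi(ss^{-1})=1\}$, $(s.\chi)(e)=\chi(s^{-1}es)$; this restricts to $\partial\widehat E$. $S\ltimes\partial\widehat E$ is the set of classes $[s,\chi]$ of pairs $(s,\chi)\in S\times\partial\widehat E$ with $\chi(s^{-1}s)=1$, where $[s,\chi]=[t,\psi]$ iff $\chi=\psi$ and $se=te$ for some $e\in E$ with $\chi(e)=1$; source $\chi$, range $s.\chi$, $[s,t.\chi][t,\chi]=[st,\chi]$, $[s,\chi]^{-1}=[s^{-1},s.\chi]$; the topology is the one for which the sets $\{[s,\chi]:\chi\in\partial\widehat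 E,\ \chi(s^{-1}s)=1\}$ are open and the source map restricts to homeomorphisms from them onto $\{\chi\in\partial\widehat E:\chi(s^{-1}s)=1\}$. The unit space is identified with $\partial\widehat E$. $S^c:=\{s\in S: e(ses^{-1})\ne0\text{ for all }e\in E\text{ with }0\ne e\le s^{-1}s\}$, and $S^c\ltimes\partial\widehat E:=\{[s,\chi]\in S\ltimes\partial\widehat E:s\in S^c\}$, an open subgroupoid. An étale groupoid $\mathcal G$ (not necessarily Hausdorff) is topologically free if for every open bisection $\gamma\subseteq\mathcal G\setminus\mathcal G^{(0)}$, the set $\{x\in\mathcal G^{(0)}:\mathcal G_x^x\cap\gamma\ne\emptyset\}$ has empty interior. *)

(* Defs.v *)
From HB Require Import structures.
From mathcomp Require Import all_boot monoid all_classical.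
From mathcomp Require Import topology function_spaces.

Set Implicit Arguments.
Unset Strict Implicit.
Unset Printing Implicit Defensive.

Local Open Scope classical_set_scope.

(** * Inverse semigroups with zero *)

HB.mixin Record Semigroup_isInverse0 S of Semigroup S := {
  szero : S;
  sinv : S -> S;
  smul0s : forall s, mul szero s = szero;
  smuls0 : forall s, mul s szero = szero;
  smulsVs : forall s, mul (mul s (sinv s)) s = s;
  smulVsV : forall s, mul (mul (sinv s) s) (sinv s) = sinv s;
  sinv_uniq : forall s t,
    mul (mul s t) s = s -> mul (mul t s) t = t -> t = sinv s
}.

#[short(type="invSemigroup0Type")]
HB.structure Definition InverseSemigroup0 :=
  {S of Semigroup_isInverse0 S & Semigroup S}.

(* Within [group_scope], [^-1] henceforth denotes the inverse in an inverse
   semigroup rather than in a [baseGroupType]. *)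
Notation "x ^-1" := (sinv x) : group_scope.
Notation "0" := szero : group_scope.
Local Open Scope group_scope.

Section InverseSemigroupTheory.
Variable S : invSemigroup0Type.
Implicit Types s t e f : S.

Definition idempotent s : bool := s * s == s.

Lemma sinvK s : s^-1^-1 = s.
Proof. by symmetry; apply: sinv_uniq; rewrite ?smulsVs ?smulVsV. Qed.

Lemma idem_inv e : idempotent e -> e^-1 = e.
Proof. by move=> /eqP ee; symmetry; apply: sinv_uniq; rewrite !ee. Qed.

Lemma idem_idemM e f : idempotent e -> idempotent f -> idempotent (e * f).
Proof.
move=> /eqP ee /eqP ff; set x := (e * f)^-1.
have efxef : e * f * x * (e * f) = e * f by rewrite smulsVs.
have xefx : x * (e * f) * x = x by rewrite smulVsV.
have fxe : f * x * e = x.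
  apply: sinv_uniq.
    rewrite -[RHS]efxef !mulgA -(mulgA e f f) ff.
    by rewrite -(mulgA (e * f * x) e e) ee.
  rewrite !mulgA -(mulgA (f * x) e e) ee -(mulgA (f * x * e) f f) ff.
  by rewrite -[in RHS]xefx !mulgA.
have xx : idempotent x.
  apply/eqP; rewrite -{1 2}fxe !mulgA -[RHS]fxe -[in RHS]xefx !mulgA.
  by [].
have <- : x^-1 = e * f by rewrite sinvK.
by rewrite idem_inv.
Qed.

Lemma idemC e f : idempotent e -> idempotent f -> e * f = f * e.
Proof.
move=> ie jf.
have /eqP ef := idem_idemM ie jf; have /eqP fe := idem_idemM jf ie.
move/eqP: (ie) => ee; move/eqP: (jf) => ff.
rewrite -[LHS](idem_inv (idem_idemM ie jf)); symmetry; apply: sinv_uniq.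
  by rewrite !mulgA -(mulgA e f f) ff -(mulgA (e * f) e e) ee -mulgA.
by rewrite !mulgA -(mulgA f e e) ee -(mulgA (f * e) f f) ff -mulgA.
Qed.

Lemma idem0 : idempotent (0 : S).
Proof. by rewrite /idempotent smul0s. Qed.

Lemma idemVs s : idempotent (s^-1 * s).
Proof. by rewrite /idempotent mulgA smulVsV. Qed.

Lemma idemsV s : idempotent (s * s^-1).
Proof. by rewrite /idempotent mulgA smulsVs. Qed.

Lemma sinvM s t : (s * t)^-1 = t^-1 * s^-1.
Proof.
have c := idemC (idemsV t) (idemVs s).
symmetry; apply: sinv_uniq; rewrite !mulgA.
  rewrite -(mulgA (s * t * t^-1)) -(mulgA s) -(mulgA s) c !mulgA smulsVs.
  by rewrite -!mulgA (mulgA t) smulsVs.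
rewrite -(mulgA (t^-1 * s^-1 * s)) -(mulgA t^-1) -(mulgA t^-1) -c !mulgA.
by rewrite smulVsV -!mulgA (mulgA s^-1) smulVsV.
Qed.

Lemma idem_conj s e : idempotent e -> idempotent (s^-1 * e * s).
Proof.
move=> ie; move/eqP: (ie) => ee; rewrite /idempotent !mulgA.
rewrite -(mulgA (s^-1 * e)) -(mulgA s^-1) (idemC ie (idemsV s)) !mulgA.
by rewrite smulVsV -(mulgA s^-1) ee.
Qed.

Lemma conj_idemM s e f : idempotent e -> idempotent f ->
  s^-1 * (e * f) * s = s^-1 * e * s * (s^-1 * f * s).
Proof.
move=> ie jf; rewrite !mulgA -(mulgA (s^-1 * e) s) -(mulgA s^-1 e (s * _)).
by rewrite (idemC ie (idemsV s)) !mulgA smulVsV.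
Qed.

End InverseSemigroupTheory.

(** * The semilattice of idempotents and its spectrum *)

Record idem (S : invSemigroup0Type) := Idem {
  idem_val :> (S : magmaType);
  idemP : idempotent idem_val
}.
HB.instance Definition _ S := [isSub for @idem_val S].
HB.instance Definition _ S := [Choice of idem S by <:].

Section Spectrum.
Variable S : invSemigroup0Type.
Implicit Types (s t : S) (e f : idem S).

Definition idem_zero : idem S := Idem (idem0 S).
Definition idem_mul e f : idem S := Idem (idem_idemM (idemP e) (idemP f)).
Definition idem_src s : idem S := Idem (idemVs s).
Definition idem_rng s : idem S := Idem (idemsV s).
Definition idem_conjV s e : idem S := Idem (idem_conj s (idemP e)).

Definition idem_le e f : Prop := idem_mul e f = e.

Notation chars := {ptws idem S -> bool}.
Implicit Types x y : chars.

Definition spectrum : set chars := [set x : chars |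
  [/\ exists e, x e, x idem_zero = false
    & forall e f, x (idem_mul e f) = x e && x f]].

Definition char_filter x : set (idem S) := [set e | x e].

Definition spectrum_max : set chars := [set x : chars | spectrum x /\
  forall y, spectrum y -> char_filter x `<=` char_filter y ->
    char_filter x = char_filter y].

(* closure relative to the subspace [spectrum] *)
Definition tight_spectrum : set chars := spectrum `&` closure spectrum_max.

Definition char_dom s x : bool := x (idem_src s).

(* The formula makes sense for all [x]; it is the action of [s] on those with
   [char_dom s x]. *)
Definition char_act s x : chars := fun e => x (idem_conjV s e).

Lemma idem_eq e f : idem_val e = idem_val f -> e = f.
Proof. by move=> ef; apply: val_inj. Qed.

Lemma char_eq x y : (forall e, x e = y e) -> x = y.
Proof. by move=> xy; apply: funext. Qed.

Lemma eval_clopen e (b : bool) : open [set x : chars | x e = b].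
Proof.
have cp : continuous (fun x : chars => x e) by exact: proj_continuous.
by move/continuousP: cp => /(_ [set b] (discrete_open _)).
Qed.

Lemma continuous_to_chars (T : topologicalType) (f : T -> chars) :
  (forall e (b : bool), open [set t | f t e = b]) -> continuous f.
Proof.
move=> fo t; apply/cvg_sup => e U.
have /= -> := @nbhsE (initial_topology (fun g : idem S -> bool => g e)) (f t).
case=> B [[C oC <-]] Cft /filterS; apply.
rewrite /= nbhsE; exists [set u | f u e = f t e]; first by split=> //; exact: fo.
by move=> u /= ue; rewrite ue.
Qed.

Lemma char_act_continuous s : continuous (char_act s).
Proof. by apply: continuous_to_chars => e b; exact: eval_clopen. Qed.

Lemma spectrumM x e f : spectrum x -> x (idem_mul e f) = x e && x f.
Proof. by case=> _ _ ->. Qed.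

Lemma char_domV s x : char_dom s x -> char_dom s^-1 (char_act s x).
Proof.
rewrite /char_dom /char_act; congr is_true; congr x.
by apply: idem_eq => /=; rewrite sinvK !mulgA smulVsV.
Qed.

Lemma char_domM s t x : char_dom s (char_act t x) = char_dom (s * t) x.
Proof.
rewrite /char_dom /char_act; congr x; apply: idem_eq => /=.
by rewrite sinvM !mulgA.
Qed.

Lemma char_actM s t x : char_act (s * t) x = char_act s (char_act t x).
Proof.
apply: char_eq => e; rewrite /char_act; congr x; apply: idem_eq => /=.
by rewrite sinvM !mulgA.
Qed.

Lemma char_dom_idem e x : char_dom (idem_val e) x = x e.
Proof.
rewrite /char_dom; congr x; apply: idem_eq => /=.
by rewrite (idem_inv (idemP e)); apply/eqP; exact: idemP.
Qed.

Lemma char_act_germ s t x e : spectrum x -> x e -> s * e = t * e ->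
  char_act s x = char_act t x.
Proof.
move=> xs xe st; apply: char_eq => f; rewrite /char_act.
have h u : x (idem_conjV u f) =
    x (idem_mul (idem_mul e (idem_conjV u f)) e).
  by rewrite !spectrumM // xe andbT.
rewrite !h; congr x; apply: idem_eq => /=.
have k u : e * (u^-1 * f * u) * e = (u * e)^-1 * f * (u * e) :> S.
  by rewrite sinvM (idem_inv (idemP e)) !mulgA.
by rewrite !k st.
Qed.

Lemma char_dom_germ s t x e : spectrum x -> x e -> s * e = t * e ->
  char_dom s x = char_dom t x.
Proof.
move=> xs xe st.
have h u : char_dom u x = x (idem_mul (idem_mul e (idem_src u)) e).
  by rewrite !spectrumM // xe andbT.
rewrite !h; congr x; apply: idem_eq => /=.
have k u : e * (u^-1 * u) * e = (u * e)^-1 * (u * e) :> S.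
  by rewrite sinvM (idem_inv (idemP e)) !mulgA.
by rewrite !k st.
Qed.

Lemma char_act_idem e x : spectrum x -> x e -> char_act (idem_val e) x = x.
Proof.
move=> xs xe; apply: char_eq => f; rewrite /char_act.
transitivity (x (idem_mul (idem_mul e f) e)).
  by congr x; apply: idem_eq => /=; rewrite (idem_inv (idemP e)).
by rewrite !spectrumM // xe andbT.
Qed.

Lemma char_actK s x : spectrum x -> char_dom s x ->
  char_act s^-1 (char_act s x) = x.
Proof.
by move=> xs xd; rewrite -char_actM; exact: (@char_act_idem (idem_src s)).
Qed.

Lemma char_act_spectrum s x : spectrum x -> char_dom s x ->
  spectrum (char_act s x).
Proof.
move=> xs xd; split.
- exists (idem_rng s); have := char_domV xd; rewrite /char_dom.
  congr is_true; congr (char_act s x _).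
  by apply: idem_eq => /=; rewrite sinvK.
- rewrite -[RHS](_ : x idem_zero = false); last by case: xs.
  by congr x; apply: idem_eq; rewrite /= smuls0 smul0s.
- move=> e f; rewrite /char_act -spectrumM //; congr x; apply: idem_eq => /=.
  exact: conj_idemM (idemP e) (idemP f).
Qed.

Lemma char_act_max s x : spectrum_max x -> char_dom s x ->
  spectrum_max (char_act s x).
Proof.
move=> [xs xmax] xd; split; first exact: char_act_spectrum.
move=> y ys sub.
have yd : char_dom s^-1 y by apply: sub; exact: char_domV.
have xE : char_filter x = char_filter (char_act s^-1 y).
  apply: xmax; first exact: char_act_spectrum.
  move=> e /= xe; apply: sub.
  suff: char_act s^-1 (char_act s x) e by [].
  by rewrite char_actK.
suff -> : y = char_act s x by [].
have yE : char_act s^-1 y = x.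
  by apply: char_eq => e; apply/idP/idP;
    [have : char_filter (char_act s^-1 y) `<=` char_filter x by rewrite xE
    |have : char_filter x `<=` char_filter (char_act s^-1 y) by rewrite xE]; 
    exact.
by rewrite -yE -{1}(sinvK s) char_actK.
Qed.

Lemma char_act_tight s x : tight_spectrum x -> char_dom s x ->
  tight_spectrum (char_act s x).
Proof.
move=> [xs xcl] xd; split; first exact: char_act_spectrum.
move=> U Ux.
have nU : nbhs x (char_act s @^-1` U) by exact: char_act_continuous.
have nD : nbhs x (char_dom s).
  apply: open_nbhs_nbhs; split => //; exact: (eval_clopen (idem_src s) true).
have [z [zm [zU zD]]] := xcl _ (filterI nU nD).
by exists (char_act s z); split => //; exact: char_act_max.
Qed.

End Spectrum.

Arguments spectrum : clear implicits.
Arguments spectrum_max : clear implicits.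
Arguments tight_spectrum : clear implicits.

(** * Étale groupoids *)

Definition local_homeo (X Y : topologicalType) (f : X -> Y) : Prop :=
  continuous f /\
  forall x, exists U : set X, [/\ open U, U x, {in U &, injective f}
    & forall V : set X, V `<=` U -> open V -> open (f @` V)].

(* The unit space is a separate type [gpd_obj], embedded in the space of arrows
   by [gpd_unit]; no separation or compactness axiom is imposed. *)
Record etaleGroupoid := EtaleGroupoid {
  gpd_arr :> topologicalType;
  gpd_obj : topologicalType;
  gpd_src : gpd_arr -> gpd_obj;
  gpd_rng : gpd_arr -> gpd_obj;
  gpd_unit : gpd_obj -> gpd_arr;
  gpd_inv : gpd_arr -> gpd_arr;
  gpd_mul : forall g h, gpd_src g = gpd_rng h -> gpd_arr;
  gpd_src_unit : forall x, gpd_src (gpd_unit x) = x;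
  gpd_rng_unit : forall x, gpd_rng (gpd_unit x) = x;
  gpd_src_inv : forall g, gpd_src (gpd_inv g) = gpd_rng g;
  gpd_rng_inv : forall g, gpd_rng (gpd_inv g) = gpd_src g;
  gpd_src_mul : forall g h (gh : gpd_src g = gpd_rng h),
    gpd_src (gpd_mul gh) = gpd_src h;
  gpd_rng_mul : forall g h (gh : gpd_src g = gpd_rng h),
    gpd_rng (gpd_mul gh) = gpd_rng g;
  gpd_mulA : forall g h k (gh : gpd_src g = gpd_rng h)
    (hk : gpd_src h = gpd_rng k) (gh_k : gpd_src (gpd_mul gh) = gpd_rng k)
    (g_hk : gpd_src g = gpd_rng (gpd_mul hk)), gpd_mul gh_k = gpd_mul g_hk;
  gpd_mul1g : forall g (p : gpd_src (gpd_unit (gpd_rng g)) = gpd_rng g),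
    gpd_mul p = g;
  gpd_mulg1 : forall g (p : gpd_src g = gpd_rng (gpd_unit (gpd_src g))),
    gpd_mul p = g;
  gpd_mulVg : forall g (p : gpd_src (gpd_inv g) = gpd_rng g),
    gpd_mul p = gpd_unit (gpd_src g);
  gpd_mulgV : forall g (p : gpd_src g = gpd_rng (gpd_inv g)),
    gpd_mul p = gpd_unit (gpd_rng g);
  gpd_unit_continuous : continuous gpd_unit;
  gpd_inv_continuous : continuous gpd_inv;
  gpd_mul_continuous : continuous
    (fun p : [set p : gpd_arr * gpd_arr | gpd_src p.1 = gpd_rng p.2] =>
       gpd_mul (set_valP p));
  gpd_src_local_homeo : local_homeo gpd_src;
  gpd_rng_local_homeo : local_homeo gpd_rng
}.

Section TopologicallyFree.
Variable G : etaleGroupoid.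

Definition gpd_units : set G := range (@gpd_unit G).

(* Since the source and range maps are local homeomorphisms, injectivity makes
   them homeomorphisms from [B] onto open subsets of the unit space. *)
Definition open_bisection (B : set G) : Prop :=
  [/\ open B, {in B &, injective (@gpd_src G)}
    & {in B &, injective (@gpd_rng G)}].

Definition isotropy (x : gpd_obj G) : set G :=
  [set g | gpd_src g = x /\ gpd_rng g = x].

Definition topologically_free : Prop :=
  forall B : set G, open_bisection B -> B `<=` ~` gpd_units ->
    [set x | isotropy x `&` B !=set0]° = set0.

End TopologicallyFree.

Lemma continuous_to_set_type (T Y : topologicalType) (A : set Y) (f : T -> A) :
  continuous (set_val \o f) -> continuous f.
Proof.
move=> /continuousP cf; apply/continuousP => _ [B oB <-].
exact: (cf _ oB).
Qed.

Section OpenSubgroupoid.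
Variables (G : etaleGroupoid) (H : set G).
Hypotheses (Ho : open H) (H1 : forall x, H (gpd_unit x))
  (HV : forall g, H g -> H (gpd_inv g))
  (HM : forall g h (gh : gpd_src g = gpd_rng h), H g -> H h -> H (gpd_mul gh)).

Let src (g : H) : gpd_obj G := gpd_src (set_val g).
Let rng (g : H) : gpd_obj G := gpd_rng (set_val g).
Let unit (x : gpd_obj G) : H := SigSub (mem_set (H1 x)).
Let inv (g : H) : H := SigSub (mem_set (HV (set_valP g))).
Let mul (g h : H) (gh : src g = rng h) : H :=
  SigSub (mem_set (HM gh (set_valP g) (set_valP h))).

Let val_cont : continuous (set_val : H -> G).
Proof. exact: initial_continuous. Qed.

Let restr_lh (f : G -> gpd_obj G) :
  local_homeo f -> local_homeo (f \o (set_val : H -> G)).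
Proof.
move=> [cf lf]; split.
  by move=> g; apply: continuous_comp; [exact: val_cont | exact: cf].
move=> g; have [U [oU Ug injU opU]] := lf (set_val g).
exists (set_val @^-1` U); split => //.
- by exists U.
- move=> a b; rewrite !inE => Ua Ub fab; apply: val_inj.
  by apply: injU; rewrite ?inE.
- move=> V VU [A oA AV]; move: VU; rewrite -{V}AV => VU.
  have -> : (f \o set_val) @` (set_val @^-1` A : set H) =
            f @` (A `&` H `&` U).
    apply/seteqP; split => x.
      move=> [a Aa <-]; exists (set_val a) => //; split; last exact: VU.
      by split => //; exact: set_valP.
    move=> [a [[Aa Ha] Ua] <-].
    by exists (SigSub (mem_set Ha)).
  by apply: opU => [a []//|]; do !apply: openI.
Qed.

Definition open_subgroupoid : etaleGroupoid.
Proof.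
refine (@EtaleGroupoid H (gpd_obj G) src rng unit inv mul
  _ _ _ _ _ _ _ _ _ _ _ _ _ _ _ _).
- by move=> x; exact: gpd_src_unit.
- by move=> x; exact: gpd_rng_unit.
- by move=> g; exact: gpd_src_inv.
- by move=> g; exact: gpd_rng_inv.
- by move=> g h gh; exact: gpd_src_mul.
- by move=> g h gh; exact: gpd_rng_mul.
- by move=> *; apply: val_inj; exact: gpd_mulA.
- by move=> *; apply: val_inj; exact: gpd_mul1g.
- by move=> *; apply: val_inj; exact: gpd_mulg1.
- by move=> *; apply: val_inj; exact: gpd_mulVg.
- by move=> *; apply: val_inj; exact: gpd_mulgV.
- by apply: continuous_to_set_type; exact: gpd_unit_continuous.
- apply: continuous_to_set_type => g.
  apply: (@continuous_comp H G G set_val (@gpd_inv G)); first exact: val_cont.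
  exact: gpd_inv_continuous.
- apply: continuous_to_set_type.
  pose P := [set p : H * H | src p.1 = rng p.2].
  pose Q := [set p : G * G | gpd_src p.1 = gpd_rng p.2].
  pose k (p : P) : Q :=
    @exist _ _ (set_val (set_val p).1, set_val (set_val p).2)
      (@mem_set _ Q (_, _) (set_valP p)).
  have kc : continuous k.
    apply: continuous_to_set_type.
    have pc : continuous (set_val : P -> H * H) by exact: initial_continuous.
    have c1 : continuous (fun p : P => set_val (set_val p).1 : G).
      move=> p; apply: (@continuous_comp P H G (fun p => (set_val p).1) set_val).
        by apply: (continuous_comp (pc p)); exact: cvg_fst.
      exact: val_cont.
    have c2 : continuous (fun p : P => set_val (set_val p).2 : G).
      move=> p; apply: (@continuous_comp P H G (fun p => (set_val p).2) set_val).
        by apply: (continuous_comp (pc p)); exact: cvg_snd.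
      exact: val_cont.
    by move=> p; apply: cvg_pair; [exact: nbhs_filter | exact: c1 | exact: c2].
  rewrite (_ : _ \o _ = (fun q : Q => gpd_mul (set_valP q)) \o k).
    move=> p; apply: continuous_comp; first exact: kc.
    exact: gpd_mul_continuous.
  apply: funext => p /=; congr gpd_mul; exact: Prop_irrelevance.
- exact: restr_lh (gpd_src_local_homeo G).
- exact: restr_lh (gpd_rng_local_homeo G).
Defined.

End OpenSubgroupoid.

(** * The groupoid of germs of the action on the tight spectrum *)

Local Open Scope quotient_scope.

Section Germs.
Variable S : invSemigroup0Type.
Local Notation tight := (set_type (tight_spectrum S)).
Implicit Types (s t : S) (e f : idem S) (x y : tight).

Definition tight_dom s x : bool := char_dom s (set_val x).

Definition tight_act s x (sx : tight_dom s x) : tight :=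
  @exist _ _ (char_act s (set_val x))
    (mem_set (char_act_tight (set_valP x) sx)).

Definition germ_pair := {p : S * tight | tight_dom p.1 p.2}.

Definition germ_rel (p q : germ_pair) : bool :=
  `[< (val p).2 = (val q).2 /\
      exists2 e : idem S, (set_val (val p).2) e
        & (val p).1 * e = (val q).1 * e >].

Let tspec x : spectrum S (set_val x).
Proof. by have [] := set_valP x. Qed.

Fact germ_refl : reflexive germ_rel.
Proof.
move=> p; apply/asboolP; split=> //.
by exists (idem_src (val p).1) => //; exact: (valP p).
Qed.

Fact germ_sym : symmetric germ_rel.
Proof.
move=> p q; apply/idP/idP => /asboolP [E [e pe st]]; apply/asboolP;
  by split=> //; exists e => //; rewrite -?E // E.
Qed.

Fact germ_trans : transitive germ_rel.
Proof.
move=> q p r /asboolP [E [e pe st]] /asboolP [F [f qf tu]].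
apply/asboolP; split; first by rewrite E.
exists (idem_mul e f); first by rewrite spectrumM // pe E.
by rewrite /= mulgA st -!mulgA (idemC (idemP e) (idemP f)) !mulgA tu.
Qed.

Canonical germ_equiv := EquivRel germ_rel germ_refl germ_sym germ_trans.

Definition germs : Type := {eq_quot germ_equiv}%qT.
HB.instance Definition _ := Choice.on germs.
HB.instance Definition _ := Quotient.on germs.

Definition germ s x (sx : tight_dom s x) : germs :=
  \pi_germs (@exist _ _ (s, x) sx).

Lemma germ_ind (P : germs -> Prop) :
  (forall s x (sx : tight_dom s x), P (germ sx)) -> forall g, P g.
Proof.
by move=> h g; elim/quotW: g => -[[s x] sx]; exact: h.
Qed.

Lemma germ_eqP s x (sx : tight_dom s x) t y (ty : tight_dom t y) :
  germ sx = germ ty <->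
  x = y /\ exists2 e : idem S, (set_val x) e & s * e = t * e.
Proof.
split; first by move=> /eqmodP/asboolP.
by move=> h; apply/eqmodP/asboolP.
Qed.

(* The structure maps are defined on representatives; [germ_srcE], [germ_rngE],
   [germ_invE] and [germ_mulE] give their values on arbitrary germs. *)
Definition germ_src (g : germs) : tight := (val (repr g)).2.
Definition germ_rng (g : germs) : tight := tight_act (valP (repr g)).

Lemma germ_srcE s x (sx : tight_dom s x) : germ_src (germ sx) = x.
Proof.
rewrite /germ_src /germ; case: piP => q /eqmodP/asboolP [] //.
Qed.

Lemma tight_val_inj x y : set_val x = set_val y -> x = y.
Proof. by move=> xy; apply: val_inj. Qed.

Lemma germ_rngE s x (sx : tight_dom s x) : germ_rng (germ sx) = tight_act sx.
Proof.
rewrite /germ_rng; move: (valP (repr (germ sx))).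
rewrite /germ; case: piP => -[[t y] ty] /eqmodP/asboolP [/= <- [e xe st]] ty'.
by apply: tight_val_inj; exact: char_act_germ xe _.
Qed.

Lemma tight_domVs s x (sx : tight_dom s x) : tight_dom s^-1 (tight_act sx).
Proof. exact: char_domV. Qed.

Fact germ_mul_dom g h : germ_src g = germ_rng h ->
  tight_dom ((val (repr g)).1 * (val (repr h)).1) (germ_src h).
Proof.
move=> gh; rewrite /tight_dom -char_domM.
by have := valP (repr g); rewrite /= -/(germ_src g) gh.
Qed.

Definition germ_mul g h (gh : germ_src g = germ_rng h) : germs :=
  germ (germ_mul_dom gh).

Definition germ_inv (g : germs) : germs := germ (tight_domVs (valP (repr g))).

Lemma germ_mul_aux s s' t t' (e f : S) : idempotent e -> idempotent f ->
  s' * e = s * e -> t' * f = t * f ->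
  s' * t' * (t^-1 * e * t * f) = s * t * (t^-1 * e * t * f).
Proof.
move=> ie jf se tf.
have tk : t' * (t^-1 * e * t * f) = t * (t^-1 * e * t * f).
  by rewrite (idemC (idem_conj t ie) jf) !mulgA tf.
have tek : t * (t^-1 * e * t * f) = e * t * f.
  rewrite !mulgA (idemC (idemsV t) ie) !mulgA.
  by rewrite -(mulgA e t t^-1) -(mulgA e _ t) smulsVs.
by rewrite -(mulgA s' t') tk -(mulgA s t) tek !mulgA se.
Qed.

Lemma germ_mulE s t x (tx : tight_dom t x) (stx : tight_dom s (tight_act tx))
    (p : germ_src (germ stx) = germ_rng (germ tx))
    (q : tight_dom (s * t) x) :
  germ_mul p = germ q.
Proof.
rewrite /germ_mul; apply/germ_eqP; split; first exact: germ_srcE.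
rewrite germ_srcE.
move=> {p}.
have := reprK (germ stx); have := reprK (germ tx).
case: (repr (germ tx)) => -[t' y] /= ty /eqmodP/asboolP [/= -> [f xf tf]].
case: (repr (germ stx)) => -[s' z] /= sz /eqmodP/asboolP [/= -> [e xe se]].
exists (idem_mul (idem_conjV t e) f); first by rewrite spectrumM // xf andbT.
exact: (germ_mul_aux (idemP e) (idemP f)).
Qed.

Lemma germ_unit_subproof x : exists e, (set_val x) e.
Proof. by have [] := tspec x. Qed.

Lemma germ_unit_dom x :
  tight_dom (idem_val (xchoose (germ_unit_subproof x))) x.
Proof. by rewrite /tight_dom char_dom_idem; exact: xchooseP. Qed.

Definition germ_unit x : germs := germ (germ_unit_dom x).

Lemma germ_unitE e x (ex : tight_dom (idem_val e) x) : germ_unit x = germ ex.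
Proof.
apply/germ_eqP; split=> //; set f := xchoose _.
have xf : set_val x f by exact: xchooseP.
have xe : set_val x e by rewrite -char_dom_idem.
exists (idem_mul e f); first by rewrite spectrumM // xe.
rewrite /= !mulgA (idemC (idemP f) (idemP e)) -(mulgA _ f f) (eqP (idemP f)).
by rewrite (eqP (idemP e)).
Qed.

(* For the maps [x |-> germ s x], defined on the open sets [tight_dom s], to be
   homeomorphisms onto open sets (inverse to the source map), a set of germs
   must be open exactly when its preimages under all of them are.  That this
   topology has the required property is [germ_slice_open] and
   [germ_src_local_homeo]. *)
Definition germ_open (U : set germs) : Prop :=
  forall s, open [set x | exists sx : tight_dom s x, U (germ sx)].

Lemma tight_eval_open e : open [set x : tight | set_val x e].
Proof. by exists [set x | x e = true] => //; exact: eval_clopen. Qed.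

Lemma tight_dom_open s : open [set x : tight | tight_dom s x].
Proof. exact: tight_eval_open. Qed.

Fact germ_openT : germ_open setT.
Proof.
move=> s; have -> : [set x | exists sx : tight_dom s x, setT (germ sx)] =
  [set x : tight | tight_dom s x].
  by apply/seteqP; split=> x; [case | move=> sx; exists sx].
exact: tight_dom_open.
Qed.

Fact germ_openI : setI_closed germ_open.
Proof.
move=> U V oU oV s; have := openI (oU s) (oV s); congr open.
apply/seteqP; split=> x; first by move=> [[a Ua] [b Ub]]; exists a; split => //;
  rewrite (bool_irrelevance a b).
by move=> [a [Ua Va]]; split; exists a.
Qed.

Fact germ_open_bigU (I : Type) (f : I -> set germs) :
  (forall i, germ_open (f i)) -> germ_open (\bigcup_i f i).
Proof.
move=> fo s.
have -> : [set x | exists sx : tight_dom s x, (\bigcup_i f i) (germ sx)] =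
  \bigcup_i [set x | exists sx : tight_dom s x, f i (germ sx)].
  apply/seteqP; split=> x.
    by move=> [sx [i _ fi]]; exists i => //; exists sx.
  by move=> [i _ [sx fi]]; exists sx; exists i.
by apply: bigcup_open => i _; exact: fo.
Qed.

HB.instance Definition _ :=
  isOpenTopological.Build germs germ_openT germ_openI germ_open_bigU.

Lemma germ_openE (U : set germs) : open U = germ_open U.
Proof. by []. Qed.

Definition germ_slice s (A : set tight) : set germs :=
  [set g | exists x, exists2 sx : tight_dom s x, A x & g = germ sx].

Lemma germ_slice_open s A : open A -> open (germ_slice s A).
Proof.
move=> oA; rewrite germ_openE => t.
have -> : [set x | exists sx : tight_dom t x, germ_slice s A (germ sx)] =
  [set x | tight_dom t x] `&` [set x | tight_dom s x] `&` A `&`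
  \bigcup_(e in [set e : idem S | s * e = t * e]) [set x : tight | set_val x e].
  apply/seteqP; split=> x.
    move=> [tx [y [sy Ay /germ_eqP [-> [e ye te]]]]]; split; last by exists e.
    do !split => //; rewrite /= /tight_dom.
    by rewrite (char_dom_germ _ ye te).
  move=> [[[tx sx] Ax] [e /= se xe]]; exists tx, x; exists sx => //.
  by apply/germ_eqP; split => //; exists e.
apply: openI; last by apply: bigcup_open => e _; exact: tight_eval_open.
by apply: openI => //; apply: openI; exact: tight_dom_open.
Qed.

Lemma germ_congr s x (sx : tight_dom s x) t y (ty : tight_dom t y) :
  s = t -> x = y -> germ sx = germ ty.
Proof. by move=> st xy; subst; rewrite (bool_irrelevance sx ty). Qed.

Lemma germ_slice_germ s x (sx : tight_dom s x) : germ_slice s setT (germ sx).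
Proof. by exists x; exists sx. Qed.

Lemma germ_invE s x (sx : tight_dom s x) :
  germ_inv (germ sx) = germ (tight_domVs sx).
Proof.
rewrite /germ_inv; have := reprK (germ sx).
case: (repr (germ sx)) => -[t y] /= ty /eqmodP/asboolP [/= yx].
move: sx; rewrite -{}yx => sx [e xe te].
apply/germ_eqP; split.
  by apply: tight_val_inj; exact: char_act_germ xe te.
have sE : s * e * s^-1 = t * e * t^-1.
  have k u : u * e * u^-1 = (u * e) * (u * e)^-1.
    by rewrite sinvM (idem_inv (idemP e)) mulgA -(mulgA u e e) (eqP (idemP e)).
  by rewrite !k te.
exists (idem_conjV t^-1 e).
  rewrite -[X in is_true X](_ : set_val y (idem_mul (idem_mul (idem_src t) e) (idem_src t)) = _).
    rewrite !spectrumM // xe andbT andbb; exact: ty.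
  by rewrite /= /char_act; congr (set_val y _); apply: idem_eq;
    rewrite /= sinvK !mulgA.
rewrite /= sinvK.
have k u : u^-1 * (u * e * u^-1) = (u * e)^-1.
  rewrite sinvM (idem_inv (idemP e)) !mulgA (idemC (idemVs u) (idemP e)).
  by rewrite -(mulgA e) smulVsV.
by rewrite k -sE k te.
Qed.

Lemma germ_mul_ind (P : forall g h, germ_src g = germ_rng h -> Prop) :
  (forall s t x (tx : tight_dom t x) (stx : tight_dom s (tight_act tx)) p,
    @P (germ stx) (germ tx) p) ->
  forall g h p, @P g h p.
Proof.
move=> H g h; elim/germ_ind: h => t x tx; elim/germ_ind: g => s y sy p.
have yE : y = tight_act tx by move: (p); rewrite germ_srcE germ_rngE.
by subst y; exact: H.
Qed.

Lemma germ_mulE2 g h (p : germ_src g = germ_rng h)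
    s t x (tx : tight_dom t x) (stx : tight_dom s (tight_act tx))
    (q : tight_dom (s * t) x) :
  g = germ stx -> h = germ tx -> germ_mul p = germ q.
Proof. by move=> gE hE; subst; exact: germ_mulE. Qed.

Lemma tight_domM s t x (tx : tight_dom t x) (stx : tight_dom s (tight_act tx)) :
  tight_dom (s * t) x.
Proof. by rewrite /tight_dom -char_domM. Qed.

Fact germ_src_unit x : germ_src (germ_unit x) = x.
Proof. exact: germ_srcE. Qed.

Fact germ_rng_unit x : germ_rng (germ_unit x) = x.
Proof.
rewrite germ_rngE; apply: tight_val_inj; apply: char_act_idem => //.
exact: xchooseP.
Qed.

Fact germ_src_inv g : germ_src (germ_inv g) = germ_rng g.
Proof. by rewrite germ_srcE. Qed.

Fact germ_rng_inv g : germ_rng (germ_inv g) = germ_src g.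
Proof.
elim/germ_ind: g => s x sx; rewrite germ_invE germ_rngE germ_srcE.
by apply: tight_val_inj; exact: char_actK.
Qed.

Fact germ_src_mul g h (gh : germ_src g = germ_rng h) :
  germ_src (germ_mul gh) = germ_src h.
Proof. exact: germ_srcE. Qed.

Fact germ_rng_mul g h (gh : germ_src g = germ_rng h) :
  germ_rng (germ_mul gh) = germ_rng g.
Proof.
elim/germ_mul_ind: gh => s t x tx stx p.
rewrite (germ_mulE _ (tight_domM stx)) !germ_rngE.
by apply: tight_val_inj; exact: char_actM.
Qed.

Fact germ_mulA g h k (gh : germ_src g = germ_rng h)
    (hk : germ_src h = germ_rng k) (gh_k : germ_src (germ_mul gh) = germ_rng k)
    (g_hk : germ_src g = germ_rng (germ_mul hk)) :
  germ_mul gh_k = germ_mul g_hk.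
Proof.
elim/germ_mul_ind: hk => t u x ux tux hk in gh gh_k g_hk *.
elim/germ_ind: g => s y sy in gh gh_k g_hk *.
have yE : y = tight_act tux by move: (gh); rewrite germ_srcE germ_rngE.
subst y.
have E1 := germ_mulE gh (tight_domM sy).
have E2 := germ_mulE hk (tight_domM tux).
have aE : tight_act tux = tight_act (tight_domM tux).
  by apply: tight_val_inj; symmetry; exact: char_actM.
have sy' : tight_dom s (tight_act (tight_domM tux)) by rewrite -aE.
rewrite (germ_mulE2 gh_k (tight_domM (tight_domM sy)) E1 erefl).
rewrite (germ_mulE2 g_hk (tight_domM sy') (germ_congr _ sy' erefl aE) E2).
by apply: germ_congr; rewrite ?mulgA.
Qed.

Fact germ_mul1g g (p : germ_src (germ_unit (germ_rng g)) = germ_rng g) :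
  germ_mul p = g.
Proof.
elim/germ_ind: g p => s x sx p.
have d : tight_dom (idem_val (idem_rng s)) (tight_act sx).
  rewrite /tight_dom char_dom_idem.
  by have := tight_domVs sx; rewrite /tight_dom /char_dom; congr (is_true (char_act _ _ _)); apply: idem_eq; rewrite /= sinvK.
have uE : germ_unit (germ_rng (germ sx)) = germ d.
  by rewrite germ_rngE; exact: germ_unitE.
rewrite (germ_mulE2 p (tight_domM d) uE erefl).
by apply: germ_congr; rewrite //= smulsVs.
Qed.

Fact germ_mulg1 g (p : germ_src g = germ_rng (germ_unit (germ_src g))) :
  germ_mul p = g.
Proof.
elim/germ_ind: g p => s x sx p.
have d : tight_dom (idem_val (idem_src s)) x.
  by rewrite /tight_dom char_dom_idem.
have uE : germ_unit (germ_src (germ sx)) = germ d.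
  by rewrite germ_srcE; exact: germ_unitE.
have aE : x = tight_act d.
  by apply: tight_val_inj; symmetry; exact: char_act_idem.
have sd : tight_dom s (tight_act d) by rewrite -aE.
rewrite (germ_mulE2 p (tight_domM sd) (germ_congr _ sd erefl aE) uE).
by apply: germ_congr; rewrite //= mulgA smulsVs.
Qed.

Fact germ_mulVg g (p : germ_src (germ_inv g) = germ_rng g) :
  germ_mul p = germ_unit (germ_src g).
Proof.
elim/germ_ind: g p => s x sx p.
rewrite (germ_mulE2 p (tight_domM (tight_domVs sx)) (germ_invE sx) erefl).
rewrite germ_srcE; symmetry.
exact: (@germ_unitE (idem_src s) x (tight_domM (tight_domVs sx))).
Qed.

Fact germ_mulgV g (p : germ_src g = germ_rng (germ_inv g)) :
  germ_mul p = germ_unit (germ_rng g).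
Proof.
elim/germ_ind: g p => s x sx p.
have aE : x = tight_act (tight_domVs sx).
  by apply: tight_val_inj; symmetry; exact: char_actK.
have sd : tight_dom s (tight_act (tight_domVs sx)) by rewrite -aE.
rewrite (germ_mulE2 p (tight_domM sd) (germ_congr _ sd erefl aE) (germ_invE sx)).
have d : tight_dom (s * s^-1) (tight_act sx) := tight_domM sd.
by rewrite germ_rngE (@germ_unitE (idem_rng s) _ d); exact: germ_congr.
Qed.

Fact germ_unit_continuous : continuous germ_unit.
Proof.
apply/continuousP => A oA.
have -> : germ_unit @^-1` A = \bigcup_e
    [set x | exists sx : tight_dom (idem_val e) x, A (germ sx)].
  apply/seteqP; split=> x /=.
    by move=> Ax; exists (xchoose (germ_unit_subproof x)) => //;
      exists (germ_unit_dom x).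
  by move=> [e _ [sx Ax]]; rewrite (germ_unitE sx).
by apply: bigcup_open => e _; exact: oA.
Qed.

Lemma tight_act_open s (A : set tight) : open A ->
  open [set x | exists sx : tight_dom s x, A (tight_act sx)].
Proof.
move=> [B oB BA].
have -> : [set x | exists sx : tight_dom s x, A (tight_act sx)] =
    [set x | tight_dom s x] `&` set_val @^-1` (char_act s @^-1` B).
  rewrite -BA; apply/seteqP; split=> x /=; first by case.
  by move=> [sx Bx]; exists sx.
apply: openI; first exact: tight_dom_open.
exists (char_act s @^-1` B) => //.
by move/continuousP: (@char_act_continuous S s); apply.
Qed.

Fact germ_inv_continuous : continuous germ_inv.
Proof.
apply/continuousP => A oA; rewrite germ_openE => s.
have := tight_act_open s (oA s^-1); congr open.
apply/seteqP; split=> x.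
  move=> [sx [sy Asy]]; exists sx; rewrite /= germ_invE.
  by rewrite (bool_irrelevance (tight_domVs sx) sy).
by move=> [sx Asx]; exists sx; exists (tight_domVs sx); rewrite -germ_invE.
Qed.

Lemma germ_srcK s : {in germ_slice s setT &, injective germ_src}.
Proof.
move=> g h; rewrite !inE => -[x [sx _ ->]] [y [sy _ ->]].
by rewrite !germ_srcE => xy; exact: germ_congr.
Qed.

Fact germ_src_local_homeo : local_homeo germ_src.
Proof.
split.
  apply/continuousP => A oA; rewrite germ_openE => s.
  have -> : [set x | exists sx : tight_dom s x, (germ_src @^-1` A) (germ sx)] =
      [set x | tight_dom s x] `&` A.
    apply/seteqP; split=> x; first by move=> [sx] /=; rewrite germ_srcE.
    by move=> [sx Ax]; exists sx; rewrite /= germ_srcE.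
  by apply: openI => //; exact: tight_dom_open.
elim/germ_ind => s x sx; exists (germ_slice s setT); split.
- exact: germ_slice_open openT.
- exact: germ_slice_germ.
- exact: germ_srcK.
move=> V VU oV; have := oV s; congr open; apply/seteqP; split=> y.
  by move=> [sy Vy]; exists (germ sy); rewrite ?germ_srcE.
move=> [g Vg <-]; have [z [sz _ gE]] := VU _ Vg.
by rewrite gE germ_srcE; exists sz; rewrite -gE.
Qed.

Fact germ_invK : involutive germ_inv.
Proof.
elim/germ_ind => s x sx; rewrite !germ_invE; apply: germ_congr.
  exact: sinvK.
by apply: tight_val_inj; exact: char_actK.
Qed.

Fact germ_rng_local_homeo : local_homeo germ_rng.
Proof.
have -> : germ_rng = germ_src \o germ_inv.
  by apply: funext => g /=; rewrite germ_src_inv.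
have [cs ls] := germ_src_local_homeo; split.
  by move=> g; apply: continuous_comp; [exact: germ_inv_continuous | exact: cs].
have io A : open A -> open (germ_inv @^-1` A).
  by move/continuousP: germ_inv_continuous; apply.
have iE A : germ_inv @` A = germ_inv @^-1` A.
  apply/seteqP; split=> g; first by move=> [h Ah <-]; rewrite /= germ_invK.
  by move=> Ag; exists (germ_inv g) => //; exact: germ_invK.
move=> g; have [U [oU Ug Uinj Uop]] := ls (germ_inv g).
exists (germ_inv @^-1` U); split => //; first exact: io.
  move=> a b; rewrite !inE => Ua Ub ab; apply: (can_inj germ_invK).
  by apply: Uinj; rewrite ?inE.
move=> V VU oV.
have -> : (germ_src \o germ_inv) @` V = germ_src @` (germ_inv @^-1` V).
  by rewrite -iE image_comp.
apply: Uop; last exact: io.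
by move=> a /VU /=; rewrite germ_invK.
Qed.

Fact germ_mul_continuous : continuous
  (fun p : [set p : germs * germs | germ_src p.1 = germ_rng p.2] =>
     germ_mul (set_valP p)).
Proof.
set P := [set p | _]; apply/continuousP => A oA.
pose W s t : set tight := [set x | exists q : tight_dom (s * t) x, A (germ q)].
have key g h (p : germ_src g = germ_rng h) : A (germ_mul p) ->
    exists s t, germ_slice s setT g /\ germ_slice t (W s t) h.
  elim/germ_mul_ind: p => s t x tx stx p.
  rewrite (germ_mulE _ (tight_domM stx)) => Aq; exists s, t.
  split; first exact: germ_slice_germ.
  by exists x; exists tx => //; exists (tight_domM stx).
have -> : (fun p : P => germ_mul (set_valP p)) @^-1` A =
  \bigcup_s \bigcup_t [set p : P | germ_slice s setT (set_val p).1 /\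
                                  germ_slice t (W s t) (set_val p).2].
  apply/seteqP; split=> -[[g h] /= gh].
    by move=> /key [s [t [gs ht]]]; exists s => //; exists t.
  move=> [s _ [t _ [/= [y [sy _ gE]] [x [tx [q Aq] hE]]]]].
  move: (set_valP _) => /= p.
  have gh' : germ_src g = germ_rng h := set_mem gh.
  have yE : y = tight_act tx.
    by move: gh'; rewrite gE hE germ_srcE germ_rngE.
  by subst y; rewrite /= (germ_mulE2 p q gE hE).
apply: bigcup_open => s _; apply: bigcup_open => t _.
have pc : continuous (set_val : P -> germs * germs).
  exact: initial_continuous.
have c1 : continuous (fun p : P => (set_val p).1).
  by move=> p; apply: (continuous_comp (pc p)); exact: cvg_fst.
have c2 : continuous (fun p : P => (set_val p).2).
  by move=> p; apply: (continuous_comp (pc p)); exact: cvg_snd.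
apply: openI.
  by move/continuousP: c1; apply; exact: germ_slice_open openT.
by move/continuousP: c2; apply; apply: germ_slice_open; exact: oA.
Qed.

Definition germ_groupoid : etaleGroupoid := @EtaleGroupoid
  germs tight germ_src germ_rng germ_unit germ_inv germ_mul
  germ_src_unit germ_rng_unit germ_src_inv germ_rng_inv
  germ_src_mul germ_rng_mul germ_mulA germ_mul1g germ_mulg1 germ_mulVg
  germ_mulgV germ_unit_continuous germ_inv_continuous germ_mul_continuous
  germ_src_local_homeo germ_rng_local_homeo.

End Germs.

Arguments germ_groupoid : clear implicits.

Section Core.
Variable S : invSemigroup0Type.
Implicit Types (s t : S) (e f : idem S).
Local Notation G := (germ_groupoid S).

Definition Sc : set S := [set s | forall e : idem S,
  e <> idem_zero S -> idem_le e (idem_src s) -> e * (s * e * s^-1) <> 0].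

Definition core_germs : set G :=
  [set g | exists s x (sx : tight_dom s x), Sc s /\ g = germ sx].

Lemma Sc_idem e : Sc (idem_val e).
Proof.
move=> f f0 /(congr1 (@idem_val S)) /= fe h; apply: f0; apply: idem_eq => /=.
rewrite (idem_inv (idemP e)) (eqP (idemP e)) in fe *.
move: h; rewrite (idem_inv (idemP e)) (idemC (idemP e) (idemP f)) fe fe.
by rewrite (eqP (idemP f)).
Qed.

Lemma ScV s : Sc s -> Sc s^-1.
Proof.
move=> Hs e e0 /(congr1 (@idem_val S)) /=; rewrite sinvK => es h.
have se : s * s^-1 * e = e by rewrite (idemC (idemsV s) (idemP e)).
have k : s * (s^-1 * e * s) * s^-1 = e.
  by rewrite !mulgA se -mulgA es.
apply: (Hs (idem_conjV s e)).
- move=> /(congr1 (@idem_val S)) /= c0; apply: e0; apply: idem_eq => /=.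
  by rewrite -k c0 smuls0 smul0s.
- by apply: idem_eq; rewrite /= !mulgA -(mulgA (_ * e) s) -(mulgA _ _ s) smulsVs.
- by rewrite /= k (idemC (idem_conj s (idemP e)) (idemP e)).
Qed.

Lemma ScM s t : Sc s -> Sc t -> Sc (s * t).
Proof.
move=> Hs Ht e e0 /(congr1 (@idem_val S)) /= es h.
pose c := idem_conj t^-1 (idemP e).
have cE : t^-1^-1 * e * t^-1 = t * e * t^-1 by rewrite sinvK.
pose g : idem S := idem_mul e (Idem c).
have gE : idem_val g = e * (t * e * t^-1) by rewrite /= cE.
have et : e * (t^-1 * t) = e.
  rewrite -[in LHS]es sinvM !mulgA -(mulgA _ t t^-1) -(mulgA _ _ t) smulsVs.
  by rewrite -[RHS]es sinvM !mulgA.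
have ts : t * e * t^-1 * (s^-1 * s) = t * e * t^-1.
  rewrite -[in RHS]es sinvM.
  have -> : t * (e * (t^-1 * s^-1 * (s * t))) * t^-1 =
    t * e * (t^-1 * ((s^-1 * s) * (t * t^-1))) by rewrite !mulgA.
  by rewrite (idemC (idemVs s) (idemsV t)) !mulgA
    -(mulgA (t * e) t^-1 t) -(mulgA (t * e) _ t^-1) smulVsV.
have g0 : g <> idem_zero S.
  move=> /(congr1 (@idem_val S)); rewrite gE; apply: Ht => //.
  by apply: idem_eq.
apply: (Hs g g0).
  by apply: idem_eq; rewrite /= cE -mulgA ts.
have -> : s * g * s^-1 = s * (t * e * t^-1) * s^-1 * (s * e * s^-1).
  have -> : s * (t * e * t^-1) * s^-1 * (s * e * s^-1) =
    s * (t * e * t^-1 * (s^-1 * s)) * e * s^-1 by rewrite !mulgA.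
  by rewrite ts gE (idemC (idemP e)) -?cE // !mulgA.
rewrite gE -[in X in X * _]cE (idemC (idemP e) c) cE.
have -> : t * e * t^-1 * e * (s * (t * e * t^-1) * s^-1 * (s * e * s^-1)) =
  t * e * t^-1 * (e * (s * t * e * (s * t)^-1)) * (s * e * s^-1).
  by rewrite sinvM !mulgA.
by rewrite h smuls0 smul0s.
Qed.

Lemma core_germs_open : open core_germs.
Proof.
have -> : core_germs = \bigcup_(s in Sc) (germ_slice s setT : set G).
  apply/seteqP; split=> g; first by
    move=> [s [x [sx [cs ->]]]]; exists s => //; exact: germ_slice_germ.
  by move=> [s cs [x [sx _ ->]]]; exists s, x, sx.
by apply: bigcup_open => s _; exact: germ_slice_open openT.
Qed.

Lemma core_germs_unit (x : gpd_obj G) : core_germs (gpd_unit x).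
Proof.
exists (idem_val (xchoose (germ_unit_subproof x))), x, (germ_unit_dom x).
by split => //; exact: Sc_idem.
Qed.

Lemma core_germs_inv (g : G) : core_germs g -> core_germs (gpd_inv g).
Proof.
move=> [s [x [sx [cs ->]]]]; exists s^-1, (tight_act sx), (tight_domVs sx).
by split; [exact: ScV | exact: germ_invE].
Qed.

Lemma core_germs_mul (g h : G) (gh : gpd_src g = gpd_rng h) :
  core_germs g -> core_germs h -> core_germs (gpd_mul gh).
Proof.
move=> [s [y [sy [cs gE]]]] [t [x [tx [ct hE]]]].
have yE : y = tight_act tx.
  by move: (gh); rewrite gE hE /= germ_srcE germ_rngE.
subst y; exists (s * t), x, (tight_domM sy); split; first exact: ScM.
exact: germ_mulE2 gE hE.
Qed.

Definition core_germ_groupoid : etaleGroupoid :=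
  open_subgroupoid core_germs_open core_germs_unit core_germs_inv
    core_germs_mul.

End Core.

Arguments Sc : clear implicits.
Arguments core_germ_groupoid : clear implicits.

(* Main.v *)
Require Import Defs.
From mathcomp Require Import all_boot monoid all_classical.
From mathcomp Require Import topology function_spaces.
Local Open Scope group_scope.

(** Everything rests on a pi-base of the tight spectrum.  By Zorn's lemma every
    nonzero idempotent [e] lies in a maximal filter, and a maximal filter [x]
    that omits [f] contains some [g] with [g f = 0].  Hence the sets
    [D(e) = {x tight : x e}] are nonempty for [e] nonzero ([exists_tight]), and
    every nonempty open set contains one of them ([tight_pibase]): it contains a
    maximal [x], and near [x] each condition [x f = 0] follows from a positive
    one.  Questions about nonempty open sets of tight filters thus become
    questions about nonzero idempotents.

    An element [s] is in [Sc] when no nonzero [g <= s^-1 s] is disjoint from its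
    conjugate, that is, when every such [D(g)] contains a filter which [s] maps
    back into [D(g)].  Since the spectrum is Hausdorff this forces [s] to fix
    all tight filters in its domain ([Sc_fix]): the core groupoid consists of
    isotropy.  Also, the germ of [s] at [x] is a unit exactly when [s h = h] for
    some [h] with [x h] ([germ_unitP]).

    (i) implies (ii) because an open bisection of the core is an open bisection
    of the whole groupoid, with the same isotropy.

    (ii) implies (iii): let [A] be the set of tight filters that contain [e] and
    omit all [f i].  It is open, and nonempty because it contains [D(f0)].  The
    germs of [s] over [A] form an open bisection of isotropy, so one of them is
    a unit; being a unit is an open condition, and any nonzero [D(f')] inside
    the set of these points gives the idempotent wanted, after multiplying by
    [e] and by the idempotent that [s] fixes.

    (iii) implies (i): suppose that the units with isotropy in an open bisection
    have an interior point.  Around it the bisection consists of germs of a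
    single [s], and as the source map is injective on it these germs are
    themselves isotropy.  So [s] fixes all the filters in some [D(e)], which
    puts [s e] in [Sc] ([fixing_Sc]); then (iii), with no [f i] at all, yields a
    nonzero [f <= e] with [s f = f], and the bisection contains a unit. *)

(** * Idempotents and maximal filters *)

Section Spectrum.
Set Implicit Arguments.
Unset Strict Implicit.
Unset Printing Implicit Defensive.
Local Open Scope classical_set_scope.

Variable S : invSemigroup0Type.
Implicit Types (s t : S) (e f g h : idem S).
Local Notation chars := {ptws idem S -> bool}.
Implicit Types x y : chars.

Lemma idem_mulC e f : idem_mul e f = idem_mul f e.
Proof. by apply: idem_eq; exact: idemC (idemP e) (idemP f). Qed.

Lemma idem_mulA e f g : idem_mul e (idem_mul f g) = idem_mul (idem_mul e f) g.
Proof. by apply: idem_eq; exact: mulgA. Qed.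

Lemma idem_mulid e : idem_mul e e = e.
Proof. by apply: idem_eq; exact/eqP/(idemP e). Qed.

Lemma idem_mulr0 e : idem_mul e (idem_zero S) = idem_zero S.
Proof. by apply: idem_eq; exact: smuls0. Qed.

Lemma idem_le_mull e f : idem_le (idem_mul e f) e.
Proof. by rewrite /idem_le idem_mulC idem_mulA idem_mulid. Qed.

Lemma idem_le_mulr e f : idem_le (idem_mul e f) f.
Proof. by rewrite idem_mulC; exact: idem_le_mull. Qed.

Lemma idem_le_trans e f g : idem_le e f -> idem_le f g -> idem_le e g.
Proof. by rewrite /idem_le => ef fg; rewrite -ef -idem_mulA fg. Qed.

Lemma idem_le_mul e f g : idem_le e (idem_mul f g) <-> idem_le e f /\ idem_le e g.
Proof.
split=> [efg|[ef eg]].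
  by split; apply: idem_le_trans efg _; [exact: idem_le_mull|exact: idem_le_mulr].
by rewrite /idem_le idem_mulA ef eg.
Qed.

Lemma idem_src_restr s e : idem_le e (idem_src s) -> idem_src (s * e) = e.
Proof.
move=> /(congr1 (@idem_val S)) /= es; apply: idem_eq.
rewrite /= sinvM (idem_inv (idemP e)) -mulgA (mulgA (sinv s)) mulgA es.
exact/eqP/(idemP e).
Qed.

Lemma char_meet x e f : spectrum S x -> x e -> x f -> x (idem_mul e f).
Proof. by move=> xs xe xf; rewrite spectrumM // xe. Qed.

Lemma char_le x e f : spectrum S x -> idem_le e f -> x e -> x f.
Proof. by move=> xs <-; rewrite spectrumM // => /andP[]. Qed.

Lemma char_neq0 x e : spectrum S x -> x e -> e <> idem_zero S.
Proof. by move=> [_ x0 _] xe e0; rewrite e0 x0 in xe. Qed.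

(** Zorn's lemma is applied to the sets that are empty or proper filters
    containing [e], described by conditions that hold for the empty set and are
    inherited by unions of chains. *)
Lemma exists_max_char e : e <> idem_zero S -> exists2 x, spectrum_max S x & x e.
Proof.
move=> e0.
pose P (A : set (idem S)) := [/\ forall a, A a -> A e, ~ A (idem_zero S)
  & forall a b, A (idem_mul a b) <-> A a /\ A b].
have [|A [[Ae A0 AM] Amax]] := @Zorn_bigcup _ P.
  move=> F FP Ftot; split.
  - by move=> a [X FX Xa]; exists X => //; have [+ _ _] := FP _ FX; apply; exact: Xa.
  - by move=> [X FX X0]; have [_ + _] := FP _ FX; exact.
  - move=> a b; split.
      move=> [X FX /=]; have [_ _ XM] := FP _ FX.
      by move=> /XM [Xa Xb]; split; exists X.
    move=> [[X FX Xa] [Y FY Yb]].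
    have [XY|YX] := Ftot _ _ FX FY.
      by exists Y => //; have [_ _ YM] := FP _ FY; apply/YM; split=> //; exact: XY.
    by exists X => //; have [_ _ XM] := FP _ FX; apply/XM; split=> //; exact: YX.
have {}Ae : A e.
  apply: contrapT => nAe; apply: (Amax [set a | idem_le e a]).
    split; first by move=> a /Ae.
    by move/(_ e (idem_mulid e)).
  split; first by move=> *; exact: idem_mulid.
    by rewrite /= /idem_le idem_mulr0 => /esym.
  by move=> a b; exact: idem_le_mul.
pose x : chars := fun a => `[< A a >].
have xE a : x a = A a :> Prop by exact: asboolE.
have xs : spectrum S x.
  split; first by exists e; exact/asboolP.
    exact/negbTE/asboolPn.
  move=> a b; apply/idP/andP; rewrite !xE; first by move/AM.
  by move=> ?; exact/AM.
exists x; last exact/asboolP.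
split=> // y ys xy; apply/seteqP; split=> // a ya; apply: contrapT => nxa.
apply: (Amax [set a | y a]).
  split; first by move=> b Ab; apply: xy; exact/asboolP.
  by move/(_ a ya) => Aa; apply: nxa; exact/asboolP.
have ye : y e by apply: xy; exact/asboolP.
split=> //=; first by case: ys => _ ->.
by move=> b c; rewrite spectrumM //; split=> /andP.
Qed.

(** Otherwise the elements above some [g f] with [x g] would form a strictly
    larger proper filter. *)
Lemma max_char_disjoint x f : spectrum_max S x -> ~~ x f ->
  exists2 g, x g & idem_mul g f = idem_zero S.
Proof.
move=> [xs xmax] /negP nxf; apply: contrapT => nex; apply: nxf.
pose y : chars := fun h => `[< exists2 g, x g & idem_le (idem_mul g f) h >].
have [[e xe] x0 _] := xs.
have ys : spectrum S y.
  split.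
  - by exists f; apply/asboolP; exists e => //; exact: idem_le_mulr.
  - apply/negbTE/asboolPn => -[g xg]; rewrite /idem_le idem_mulr0 => gf.
    by apply: nex; exists g.
  - move=> a b; apply/idP/andP => [/asboolP|].
      by move=> [g xg /idem_le_mul[ga gb]]; split; apply/asboolP; exists g.
    move=> [/asboolP [g xg ga] /asboolP [h xh hb]]; apply/asboolP.
    exists (idem_mul g h); first exact: char_meet.
    apply/idem_le_mul; split.
      apply: idem_le_trans ga; apply/idem_le_mul; split; last exact: idem_le_mulr.
      exact: idem_le_trans (idem_le_mull _ _) (idem_le_mull _ _).
    apply: idem_le_trans hb; apply/idem_le_mul; split; last exact: idem_le_mulr.
    exact: idem_le_trans (idem_le_mull _ _) (idem_le_mulr _ _).
have xy : char_filter x `<=` char_filter y.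
  move=> g xg; apply/asboolP; exists g => //; exact: idem_le_mull.
have : char_filter y f.
  by apply/asboolP; exists e => //; exact: idem_le_mulr.
by rewrite -(xmax y ys xy).
Qed.

(** By [max_char_disjoint], excluding finitely many idempotents from a maximal
    filter can be replaced by a single positive condition. *)
Lemma max_char_nbhs x (U : set chars) : spectrum_max S x -> nbhs x U ->
  exists2 g, x g & forall y, spectrum S y -> y g -> U y.
Proof.
move=> xm; have [xs _] := xm.
pose F : set_system chars := [set A : set chars |
  exists2 g, x g & forall y, spectrum S y -> y g -> A y].
have FF : Filter F.
  split.
  - by have [[e xe] _ _] := xs; exists e.
  - move=> A B [g xg gA] [h xh hB]; exists (idem_mul g h); first exact: char_meet.
    move=> y ys; rewrite spectrumM // => /andP[yg yh].
    by split; [exact: gA|exact: hB].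
  - by move=> A B AB [g xg gA]; exists g => // y ys yg; exact/AB/gA.
suff : F --> x by exact.
apply/cvg_sup => e V.
have /= -> := @nbhsE (initial_topology (fun g : idem S -> bool => g e)) x.
case=> B [[C oC <-]] Cx /filterS; apply.
suff [g xg gE] : exists2 g, x g & forall y, spectrum S y -> y g -> y e = x e.
  by exists g => // y ys yg; rewrite /= gE.
have [xe|/(max_char_disjoint xm) [g xg ge]] := boolP (x e); first by exists e.
exists g => // y ys yg; apply/negbTE/negP => ye.
exact: (char_neq0 ys (char_meet ys yg ye)).
Qed.

End Spectrum.

(** * A pi-base of the tight spectrum, and the action of the core *)

Section TightSpectrum.
Set Implicit Arguments.
Unset Strict Implicit.
Unset Printing Implicit Defensive.
Local Open Scope classical_set_scope.

Variable S : invSemigroup0Type.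
Local Notation "x ^-1" := (sinv x) : group_scope.
Local Notation tight := (set_type (tight_spectrum S)).
Implicit Types (s t : S) (e f g h : idem S) (x y : tight).

Lemma tight_char x : spectrum S (set_val x).
Proof. by have [] := set_valP x. Qed.

Lemma max_char_tight (z : {ptws idem S -> bool}) :
  spectrum_max S z -> tight_spectrum S z.
Proof. by move=> zm; split; [case: zm|exact: subset_closure]. Qed.

Lemma exists_tight e : e <> idem_zero S -> exists x, set_val x e.
Proof.
move=> /exists_max_char [z /max_char_tight zt ze].
by exists (SigSub (mem_set zt)).
Qed.

(** The maximal filters are dense, and [max_char_nbhs] describes their
    neighbourhoods: together with [exists_tight], the sets of tight filters
    containing a given nonzero idempotent form a pi-base. *)
Lemma tight_pibase (A : set tight) x : open A -> A x ->
  exists2 e, e <> idem_zero S & forall y, set_val y e -> A y.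
Proof.
move=> [B oB <-] Bx; have [_ xcl] := set_valP x.
have [z [zm Bz]] := xcl _ (open_nbhs_nbhs (conj oB Bx)).
have [e ze eB] := max_char_nbhs zm (open_nbhs_nbhs (conj oB Bz)).
exists e; first by apply: char_neq0 ze; case: zm.
by move=> y ye; apply: eB => //; exact: tight_char.
Qed.

Lemma tight_eval_eq_open e (b : bool) : open [set x : tight | set_val x e = b].
Proof. by exists [set z | z e = b] => //; exact: eval_clopen. Qed.

(** By definition of [Sc] the idempotent [k] below is nonzero: a tight filter
    containing it contains [g], and so does its preimage under [s]. *)
Lemma Sc_return s g : Sc S s -> g <> idem_zero S -> idem_le g (idem_src s) ->
  exists x (sx : tight_dom s x), set_val x g /\ set_val (tight_act sx) g.
Proof.
move=> cs g0 gs; pose k := idem_mul g (idem_conjV s^-1 g).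
have k0 : k <> idem_zero S.
  move=> /(congr1 (@idem_val S)) /=; rewrite sinvK; exact: cs.
have [y yk] := exists_tight k0.
have ys := tight_char y.
have yg : set_val y g by apply: char_le yk => //; exact: idem_le_mull.
have yc : set_val y (idem_conjV s^-1 g).
  by apply: char_le yk => //; exact: idem_le_mulr.
have sy : tight_dom s^-1 y.
  apply: char_le yc => //; apply: idem_eq => /=.
  by rewrite sinvK !mulgA -(mulgA (s * g) _ s) -(mulgA (s * g)) smulVsV.
have yK : char_act s (char_act s^-1 (set_val y)) = set_val y.
  by rewrite -{1}(sinvK s) char_actK.
exists (tight_act sy); have sx : tight_dom s (tight_act sy).
  by have := tight_domVs sy; rewrite sinvK.
exists sx; split; first exact: yc.
by rewrite -[set_val _]/(char_act s (char_act (sinv s) (set_val y))) yK.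
Qed.

(** If [s] moves [x], then [x] and [s.x] differ at some [e], say [x e = b].  The
    set [A] of all [y] with [y e = b] and [(s.y) e = ~~ b] is open, so by
    [Sc_return] it contains both [y] and [s.y] for some [y]; this leaves no value
    for [(s.y) e]. *)
Lemma Sc_fix s x (sx : tight_dom s x) : Sc S s -> tight_act sx = x.
Proof.
move=> cs; apply: tight_val_inj; apply: char_eq => e /=; apply: contrapT => xne.
pose es := idem_conjV s e; pose b := set_val x e.
have xes : set_val x es = ~~ b.
  have : set_val x es <> b := xne.
  by case: (set_val x es) (b) => -[].
pose A := [set y | tight_dom s y] `&` [set y : tight | set_val y e = b] `&`
  [set y : tight | set_val y es = ~~ b].
have oA : open A.
  apply: openI; last exact: tight_eval_eq_open.
  by apply: openI; [exact: tight_dom_open|exact: tight_eval_eq_open].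
have Ax : A x by [].
have [g g0 gA] := tight_pibase oA Ax.
have [z zg] := exists_tight g0.
have h0 : idem_mul g (idem_src s) <> idem_zero S.
  apply: char_neq0 (tight_char z) _; apply: char_meet => //; first exact: tight_char.
  by have [[]] := gA z zg.
have [y [sy [yh syh]]] := Sc_return cs h0 (idem_le_mulr _ _).
have yg : set_val y g by apply: char_le (tight_char y) _ yh; exact: idem_le_mull.
have syg : set_val (tight_act sy) g.
  by apply: char_le (tight_char _) _ syh; exact: idem_le_mull.
have [_ ye] := gA y yg; have [[_ sye] _] := gA _ syg.
have : b = ~~ b by rewrite -{1}sye -ye.
by case: (b).
Qed.

Lemma germ_unitP s x (sx : tight_dom s x) :
  gpd_units (G := germ_groupoid S) (germ sx) <->
  exists2 h, set_val x h & s * h = h.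
Proof.
split=> [[y _ /esym]|[h xh sh]].
  rewrite /= /germ_unit => /germ_eqP [xy [e xe]]; set u := xchoose _ => sue.
  have xu : set_val x u by rewrite xy; exact: xchooseP.
  exists (idem_mul u e); first exact: char_meet (tight_char x) xu xe.
  by rewrite /= (idemC (idemP u) (idemP e)) mulgA sue (idemC (idemP u) (idemP e))
    -mulgA (eqP (idemP u)).
have hx : tight_dom (idem_val h) x by rewrite /tight_dom char_dom_idem.
exists x => //=; rewrite (germ_unitE hx); apply/germ_eqP; split=> //.
by exists h; rewrite // sh; exact/eqP/(idemP h).
Qed.

End TightSpectrum.

(** * Topological freeness *)

Section OpenSubgroupoid.
Local Open Scope classical_set_scope.

(** Open bisections of the subgroupoid are open bisections of the groupoid, with
    the same isotropy. *)
Lemma open_subgroupoid_topologically_free (G : etaleGroupoid) (H : set G)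
    (Ho : open H) (H1 : forall x, H (gpd_unit x))
    (HV : forall g, H g -> H (gpd_inv g))
    (HM : forall g h (gh : gpd_src g = gpd_rng h), H g -> H h -> H (gpd_mul gh)) :
  topologically_free G -> topologically_free (open_subgroupoid Ho H1 HV HM).
Proof.
move=> tfG B [oB sB rB] Bu; pose C : set G := set_val @` B.
have oC : open C.
  case: oB => D oD DB; have -> : C = D `&` H.
    apply/seteqP; split=> g.
      by move=> [[k Hk] /=]; rewrite -DB => Dk <-; split=> //; exact: set_mem.
    by move=> [Dg Hg]; exists (SigSub (mem_set Hg)) => //; rewrite -DB.
  exact: openI.
have := tfG C; rewrite /open_bisection.
have -> : [set x | isotropy x `&` C !=set0] =
          [set x | @isotropy (open_subgroupoid Ho H1 HV HM) x `&` B !=set0].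
  apply/seteqP; split=> x.
    by move=> [k [xk [g Bg gk]]]; exists g; split; rewrite // /isotropy /= -gk in xk *.
  by move=> [g [xg Bg]]; exists (set_val g); split=> //; exists g.
apply.
- split=> //.
  + by move=> _ _ /set_mem[g Bg <-] /set_mem[h Bh <-] gh; rewrite (sB g h) ?inE.
  + by move=> _ _ /set_mem[g Bg <-] /set_mem[h Bh <-] gh; rewrite (rB g h) ?inE.
- move=> _ [g Bg <-] [x _ xg]; apply: (Bu g Bg); exists x => //.
  exact: val_inj.
Qed.

End OpenSubgroupoid.

Section TopologicalFreeness.
Set Implicit Arguments.
Unset Strict Implicit.
Unset Printing Implicit Defensive.
Local Open Scope classical_set_scope.

Variable S : invSemigroup0Type.
Local Notation "x ^-1" := (sinv x) : group_scope.
Local Notation tight := (set_type (tight_spectrum S)).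
Local Notation G := (germ_groupoid S).
Local Notation Gc := (core_germ_groupoid S).
Implicit Types (s t : S) (e f g h : idem S) (x y : tight).

(** The germs of [s] at the points of [A] form an open bisection of isotropy
    germs by [Sc_fix], so it must meet the unit space. *)
Lemma core_free_germ_unit s (A : set tight) x : topologically_free Gc -> Sc S s ->
  open A -> A x -> (forall y, A y -> tight_dom s y) ->
  exists y h, [/\ A y, set_val y h & s * h = h].
Proof.
move=> tf cs oA Ax As; apply: contrapT => nunit.
pose B : set Gc := set_val @^-1` (germ_slice s A).
have Bsub (g : G) : germ_slice s A g -> germ_slice s setT g.
  by move=> [y [sy _ ->]]; exists y, sy.
have Bsrc : {in B &, injective (@gpd_src Gc)}.
  move=> g k /set_mem Bg /set_mem Bk gk; apply: val_inj.
  by apply: (@germ_srcK S s) => //; rewrite inE; exact: Bsub.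
have Brng (g : Gc) : B g -> gpd_rng g = gpd_src g.
  case: g => g gc [y [sy _ /= gE]]; rewrite /gpd_rng /gpd_src /= gE.
  by rewrite germ_rngE germ_srcE; exact: Sc_fix.
suff : (set0 : set tight) x by [].
rewrite -(tf B); last 2 first.
- split=> //; first by exists (germ_slice s A) => //; exact: germ_slice_open.
  move=> g k gB kB; rewrite (Brng g (set_mem gB)) (Brng k (set_mem kB)).
  exact: Bsrc gB kB.
- move=> g [y [sy Ay gE]] [z _ zg].
  have : gpd_units (G := G) (germ sy) by rewrite -gE -zg; exists z.
  by move=> /germ_unitP [h yh sh]; apply: nunit; exists y, h.
apply: (@interiorS _ A) => [y Ay|]; last by rewrite (interior_id A).1.
have sy := As y Ay.
have gc : core_germs (germ sy : G) by exists s, y, sy.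
pose g : Gc := SigSub (mem_set gc).
have Bg : B g by exists y, sy.
exists g; split=> //; have ys : gpd_src g = y by exact: germ_srcE.
by split; rewrite ?Brng.
Qed.

(** A set of tight filters of the form [y e] and [y (f i) = 0] for all [i] is
    open because there are finitely many [f i]. *)
Lemma core_free_fixed_idem s n e (f : 'I_n -> idem S) :
  topologically_free Gc -> Sc S s -> idem_le e (idem_src s) ->
  (exists f0, [/\ f0 <> idem_zero S, idem_le f0 e
     & forall i, idem_mul f0 (f i) = idem_zero S]) ->
  exists f', [/\ f' <> idem_zero S, idem_le f' e,
     forall i, idem_mul f' (f i) = idem_zero S & s * f' = f'].
Proof.
move=> tf cs es [f0 [f00 f0e f0f]].
pose A : set tight := [set y : tight | set_val y e] `&`
  [set y : tight | forall i, set_val y (f i) = false].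
have oA : open A.
  apply: openI; first exact: tight_eval_open.
  rewrite openE => y yf.
  apply: (@filter_forall tight _ (fun i => [set z | set_val z (f i) = false])
    (nbhs y)).
  move=> i; apply: open_nbhs_nbhs; split; last exact: yf.
  exact: tight_eval_eq_open.
have disjoint_notin x g k : set_val x g -> idem_mul g k = idem_zero S ->
    set_val x k = false.
  move=> xg gk; apply/negbTE/negP => xk.
  by apply: char_neq0 (tight_char x) (char_meet (tight_char x) xg xk) gk.
have [x xf0] := exists_tight f00.
have Ax : A x.
  split; first exact: char_le (tight_char x) f0e xf0.
  by move=> i; exact: disjoint_notin (f0f i).
have [y [h [Ay yh sh]]] := core_free_germ_unit tf cs oA Ax
  (fun y Ay => char_le (tight_char y) es Ay.1).
have oAh : open (A `&` [set y : tight | set_val y h]).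
  by apply: openI => //; exact: tight_eval_open.
have [g g0 gA] := tight_pibase oAh (conj Ay yh).
have [z zg] := exists_tight g0; have [[ze _] zh] := gA z zg.
have zs := tight_char z.
exists (idem_mul (idem_mul h e) g); split.
- exact: char_neq0 zs (char_meet zs (char_meet zs zh ze) zg).
- exact: idem_le_trans (idem_le_mull _ _) (idem_le_mulr _ _).
- (* Filters containing [g] omit [f i], so none contains their product. *)
  move=> i; apply: contrapT => /exists_tight [w wf].
  have ws := tight_char w.
  have wg : set_val w g.
    apply: char_le wf => //; apply: idem_le_trans (idem_le_mull _ _) _.
    exact: idem_le_mulr.
  have [[_ /(_ i)]] := gA w wg.
  by rewrite (char_le ws (idem_le_mulr _ _) wf).
- by rewrite /= !mulgA sh.
Qed.

(** For [k <= g] nonzero, a tight filter containing [k] is fixed by [s], hence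
    also contains [s * k * s^-1]; so the product of the two is nonzero. *)
Lemma fixing_Sc s g : idem_le g (idem_src s) ->
  (forall x (sx : tight_dom s x), set_val x g -> tight_act sx = x) ->
  Sc S (s * g).
Proof.
move=> gs fix_s k k0 ks.
have kg : idem_le k g by rewrite -(idem_src_restr gs).
have [x xk] := exists_tight k0; have xs := tight_char x.
have xg : set_val x g by exact: char_le xk.
have sx : tight_dom s x by exact: char_le xg.
have kgE : idem_val k * g = k := congr1 (@idem_val S) kg.
have -> : s * g * k * (s * g)^-1 = s * k * s^-1.
  rewrite sinvM (idem_inv (idemP g)) -(mulgA s g) (idemC (idemP g) (idemP k)).
  by rewrite kgE mulgA -(mulgA s k) kgE.
have xsk : set_val x (idem_conjV s^-1 k).
  rewrite -(fix_s x sx xg) -[set_val _ _]/(set_val x (idem_conjV s _)).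
  have <- : idem_mul (idem_mul (idem_src s) k) (idem_src s) =
            idem_conjV s (idem_conjV s^-1 k).
    by apply: idem_eq; rewrite /= sinvK !mulgA.
  by do !apply: char_meet.
have := char_neq0 xs (char_meet xs xk xsk).
by apply: contra_not => kk; apply: idem_eq; rewrite /= sinvK.
Qed.

(** The restriction [s * e] is what brings the hypothesis, which only concerns
    [Sc], to bear on an arbitrary [s]: near a point of the interior, all germs of
    [s] are isotropy. *)
Lemma germ_topologically_free :
  (forall s e, Sc S s -> idem_le e (idem_src s) -> e <> idem_zero S ->
    exists f, [/\ f <> idem_zero S, idem_le f e & s * f = f]) ->
  topologically_free G.
Proof.
move=> fixed B [oB sB _] Bu; apply/seteqP; split=> // x Vx.
have [k [[+ _]]] := interior_subset Vx.
elim/germ_ind: k => s y sx /=; rewrite germ_srcE => yx Bs; subst y.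
set V := interior _ in Vx.
have oW : open (V `&` [set y | exists sy : tight_dom s y, B (germ sy)]).
  by apply: openI; [exact: open_interior|exact: oB].
have [g g0 gW] := tight_pibase oW (conj Vx (ex_intro _ sx Bs)).
have fix_s y (sy : tight_dom s y) : set_val y g -> tight_act sy = y.
  move=> /gW [/interior_subset [k [[ks kr] Bk]] [sy' Bsy]].
  have kE : k = germ sy.
    rewrite (bool_irrelevance sy sy').
    by apply: sB; rewrite ?inE //; rewrite ks /= germ_srcE.
  by rewrite -[RHS]kr kE /= germ_rngE.
pose e := idem_mul g (idem_src s).
have es : idem_le e (idem_src s) := idem_le_mulr _ _.
have e0 : e <> idem_zero S.
  have [z zg] := exists_tight g0; have [_ [sz _]] := gW z zg.
  exact: char_neq0 (tight_char z) (char_meet (tight_char z) zg sz).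
have cse : Sc S (s * e).
  apply: fixing_Sc => // y sy ye; apply: fix_s.
  exact: char_le (tight_char y) (idem_le_mull _ _) ye.
have [|f [f0 fe sf]] := fixed _ e cse _ e0.
  by rewrite idem_src_restr //; exact: idem_mulid.
have [z zf] := exists_tight f0.
have zg : set_val z g.
  by apply: char_le (tight_char z) _ zf; exact: idem_le_trans fe (idem_le_mull _ _).
have [_ [sz Bz]] := gW z zg; apply: (Bu _ Bz).
apply/germ_unitP; exists f => //; rewrite -[RHS]sf -mulgA; congr (s * _).
rewrite (idemC (idemP e) (idemP f)); exact/esym/(congr1 (@idem_val S) fe).
Qed.

End TopologicalFreeness.

Theorem theorem5p11 (S : invSemigroup0Type) :
  (topologically_free (germ_groupoid S) <->
   topologically_free (core_germ_groupoid S)) /\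
  (topologically_free (core_germ_groupoid S) <->
   (forall (s : S) (n : nat) (e : idem S) (f : 'I_n -> idem S),
      Sc S s ->
      idem_le e (idem_src s) ->
      (forall i, idem_le (f i) e) ->
      (exists f0 : idem S,
         [/\ f0 <> idem_zero S, idem_le f0 e
           & forall i, idem_mul f0 (f i) = idem_zero S]) ->
      exists f' : idem S,
         [/\ f' <> idem_zero S, idem_le f' e,
             forall i, idem_mul f' (f i) = idem_zero S
           & s * f' = f'])).
Proof.
set iii := forall s n, _.
have i_ii : topologically_free (germ_groupoid S) ->
    topologically_free (core_germ_groupoid S).
  exact: open_subgroupoid_topologically_free.
have ii_iii : topologically_free (core_germ_groupoid S) -> iii.
  by move=> tf s n e f cs es _; exact: core_free_fixed_idem.
have iii_i : iii -> topologically_free (germ_groupoid S).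
  move=> h; apply: germ_topologically_free => s e cs es e0.
  (* The empty family gives the case of [e] alone. *)
  have [||f [f0 fe _ sf]] := h s 0%N e (fun=> e) cs es.
  - by case.
  - by exists e; split=> //; [exact: idem_mulid|case].
  - by exists f.
by split; split=> // ?; auto.
Qed.
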